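(* Let $(R_n)_{n\ge1}$ be a sequence of generalized Oppenheim random variables with associated distribution function $F$ (as in the context), and let $M_n=\max_{1\le k\le n}R_k$. Assume that the limit $\ell_0^+=\lim_{t\to0^+}\frac{F(t)}{t}$ exists as a finite number and that there exists $\beta>0$ such that $F(x)-F(y)\le\beta(x-y)$ for all $x\ge y$. Then: (i) if $\ell_0^+>0$, the sequence $(M_n)_n$ belongs to the maximum domain of attraction of the Fréchet distribution (with $\alpha=1$); precisely, $$\lim_{n\to\infty}P(M_n\le xn\ell_0^+)=\begin{cases}0& x\le0\\ e^{-1/x}& x>0;\end{cases}$$ (ii) if $\ell_0^+=0$, then $$\lim_{n\to\infty}P(M_n\le xn)=\begin{cases}0& x\le0\\ 1& x>0.\end{cases}$$
   Context: Generalized Oppenheim random variables. Let $\Omega=[0,1]$ with its Borel $\sigma$-algebra and let $P$ be Lebesgue measure; $\mathbb N^*=\{1,2,\dots\}$. Let $F$ be a (not necessarily continuous) probability distribution function with $\lim_{t\to0^+}F(t)=0$ and $\lim_{t\to1^-}F(t)\le1$, with $F(x)=0$ for $x\le0$ and $F(x)=1$ for $x\ge1$. Let $\varphi_n:\mathbb N^*\to\mathbb R^+$, $n\ge1$, be functions with $\varphi_n\ge1$, and let $q_n=q_n(h_1,\dots,h_n)\ge0$ be nonnegative numbers (possibly depending on the integers $h_1,\dots,h_n$). Put $\delta_j(h,k,q)=\frac{\varphi_j(h)(1+q)}{k+\varphi_j(h)q}$. Let $(B_n)_{n\ge1}$ be random variables on $\Omega$ with values in $\mathbb N^*$ such that,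 for all $n\ge 1$ and all positive integers with $h_1\ge1$ and $h_j\ge\varphi_{j-1}(h_{j-1})$, $j=2,\dots,n$, $$P(B_{n+1}=h_{n+1}\mid B_n=h_n,\dots,B_1=h_1)=F(\delta_n(h_n,h_{n+1},q_n))-F(\delta_n(h_n,h_{n+1}+1,q_n)).$$ Let $Q_n=q_n(B_1,\dots,B_n)$ and $$R_n=\frac{B_{n+1}+\varphi_n(B_n)Q_n}{\varphi_n(B_n)(1+Q_n)}=\frac1{\delta_n(B_n,B_{n+1},Q_n)}.$$ One has $R_n\ge1$, i.e. $B_{n+1}\ge\varphi_n(B_n)$, for every $n$. The Fréchet distribution with parameter $\alpha>0$ is $G(x)=\exp(-x^{-\alpha})$ for $x>0$, $G(x)=0$ for $x\le0$; belonging to the maximum domain of attraction of $G$ means that suitably (affinely) normalized maxima converge in distribution to $G$. *)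

(* Defs.v *)
From HB Require Import structures.
From mathcomp Require Import all_boot all_order all_algebra.
From mathcomp Require Import all_classical all_reals all_analysis.

Set Implicit Arguments.
Unset Strict Implicit.
Unset Printing Implicit Defensive.

Import Order.TTheory GRing.Theory Num.Theory.
Import numFieldNormedType.Exports.

Local Open Scope classical_set_scope.
Local Open Scope ring_scope.

(* The probability space ([0, 1], Borel, Lebesgue), carried by the type R: the
   points outside [0, 1] form a null set. *)
Section unit_lebesgue.
Context (R : realType).

Definition unit_lebesgue : set (measurableTypeR R) -> \bar R :=
  mrestr (@lebesgue_measure R) (measurable_itv `[0 : R, 1]).

HB.instance Definition _ := Measure.on unit_lebesgue.

Let unit_lebesgue_setT : unit_lebesgue setT = 1%E.
Proof.
by rewrite /unit_lebesgue /mrestr setTI lebesgue_measure_itv /= lte_fin ltr01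
  -EFinD subr0.
Qed.

HB.instance Definition _ :=
  @Measure_isProbability.Build _ _ _ unit_lebesgue unit_lebesgue_setT.

End unit_lebesgue.

(* Junk value 0 when P C = 0. *)
Definition cond_prob d (T : measurableType d) (R : realType)
    (P : probability T R) (A C : set T) : R :=
  fine (P (A `&` C)) / fine (P C).

(* Monotonicity, right continuity and the limits 0 and 1 at -oo and +oo come
   from cumulativeBounded 0 1. *)
Record oppenheim_df (R : realType) (F : cumulativeBounded (0 : R) (1 : R)) :
    Prop := {
  oppenheim_df_right0 : F t @[t --> 0^'+] --> (0 : R) ;
  oppenheim_df_left1 : exists2 l : R, F t @[t --> 1^'-] --> l & l <= 1 ;
  oppenheim_df_le0 : forall x, x <= 0 -> F x = 0 ;
  oppenheim_df_ge1 : forall x, 1 <= x -> F x = 1 }.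

(* All sequences below are indexed from 1, the terms of index 0 being unused,
   and N^* is represented by the positive elements of nat. *)
Section oppenheim.
Context (R : realType).
Implicit Types (F : cumulativeBounded (0 : R) (1 : R)) (phi : nat -> nat -> R)
  (q : forall n, n.-tuple nat -> R) (B : nat -> measurableTypeR R -> nat).

Definition oppenheim_delta phi (j h k : nat) (x : R) : R :=
  phi j h * (1 + x) / (k%:R + phi j h * x).

Definition prefix_tuple n (h : nat -> nat) : n.-tuple nat :=
  [tuple h i.+1 | i < n].

Definition oppenheim_Q q B n (w : measurableTypeR R) : R :=
  q n (prefix_tuple n (B^~ w)).

Definition oppenheim_R phi q B n (w : measurableTypeR R) : R :=
  ((B n.+1 w)%:R + phi n (B n w) * oppenheim_Q q B n w)
  / (phi n (B n w) * (1 + oppenheim_Q q B n w)).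

(* Seeding the iterated maximum with R_1 gives the exact maximum for n >= 1. *)
Definition oppenheim_max phi q B n (w : measurableTypeR R) : R :=
  \big[Num.max/oppenheim_R phi q B 1 w]_(1 <= k < n.+1)
    oppenheim_R phi q B k w.

(* The law is prescribed only along admissible histories h_1, ..., h_n of
   positive probability; h_{n+1} is an arbitrary positive integer. The last
   field is a consequence of the others when every phi_n is integer-valued, but
   not in general: then floor(phi_n(B_n)) may be given a positive probability,
   and the law of what follows is not prescribed. *)
Record oppenheim F phi q (B : {RV (@unit_lebesgue R) >-> nat}^nat) : Prop := {
  oppenheim_F : oppenheim_df F ;
  oppenheim_phi_ge1 : forall n h, (1 <= n)%N -> (1 <= h)%N -> 1 <= phi n h ;
  oppenheim_q_ge0 : forall n (h : n.-tuple nat), (1 <= n)%N ->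
    (forall i, (1 <= tnth h i)%N) -> 0 <= q n h ;
  oppenheim_B_ge1 : forall n (w : R), (1 <= n)%N -> w \in `[0, 1] ->
    (1 <= B n w)%N ;
  oppenheim_law : forall n (h : nat -> nat), (1 <= n)%N ->
    (forall j, (1 <= j <= n.+1)%N -> (1 <= h j)%N) ->
    (forall j, (2 <= j <= n)%N -> phi j.-1 (h j.-1) <= (h j)%:R) ->
    let past := [set w | forall j, (1 <= j <= n)%N -> B j w = h j] in
    (0 < unit_lebesgue past)%E ->
    cond_prob (@unit_lebesgue R) [set w | B n.+1 w = h n.+1] past =
      F (oppenheim_delta phi n (h n) (h n.+1) (q n (prefix_tuple n h)))
      - F (oppenheim_delta phi n (h n) (h n.+1).+1 (q n (prefix_tuple n h))) ;
  oppenheim_R_ge1 : {ae (@unit_lebesgue R), forall w,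
    forall n, (1 <= n)%N -> 1 <= oppenheim_R phi q B n w} }.

End oppenheim.

Definition frechet_cdf (R : realType) (alpha x : R) : R :=
  if 0 < x then expR (- (x `^ (- alpha))) else 0.

(* M is the sequence of maxima itself. Convergence in distribution is
   convergence of the distribution functions at the continuity points of G. *)
Definition in_max_domain_of_attraction d (T : measurableType d) (R : realType)
    (P : probability T R) (M : nat -> T -> R) (G : R -> R) : Prop :=
  exists a b : R^nat, (forall n, 0 < a n) /\
    forall x, {for x, continuous G} ->
      P [set w | M n w <= a n * x + b n] @[n --> \oo] --> (G x)%:E.

(* Main.v *)
Require Import Defs.
From mathcomp Require Import all_boot all_order all_algebra.
From mathcomp Require Import all_classical all_reals all_analysis.
From mathcomp Require Import ring lra.
Import Order.TTheory GRing.Theory Num.Theory.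
Import numFieldNormedType.Exports.
Local Open Scope classical_set_scope.
Local Open Scope ring_scope.
Set Implicit Arguments.
Unset Strict Implicit.

(** Each R_n exceeds a threshold y >= 1 with a conditional probability, given
    B_1, ..., B_n, that is squeezed between two deterministic numbers.  Indeed
    R_n <= y says that B_(n+1) is below some integer k+1; the prescribed law of
    B_(n+1) telescopes to 1 - F(delta(k+1)), since delta(1) >= 1 and F is 1
    there; and rounding y to an integer value of B_(n+1) only perturbs
    1 / delta by at most 1, because phi_n (1 + Q_n) >= 1.  Hence the conditional
    probability of R_n <= y lies between 1 - F(1/y) and 1 - F(1/(y+1))
    ([prob_next_R_le]).

    The event that R_1, ..., R_(n-1) are at most y depends only on
    B_1, ..., B_n, so summing over the countably many histories
    ([le_measure_fibers]) multiplies these bounds ([prob_maxima_le]):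
      (1 - F(1/y))^n <= P(M_n <= y) <= (1 - F(1/(y+1)))^n.
    When y = y_n with y_n / n -> c > 0, both n F(1/y_n) and n F(1/(y_n+1)) tend
    to l / c ([cvg_natM_tail]), and so both bounds tend to exp(-l/c)
    ([cvg_exp_1B], [cvg_prob_max]).  Taking c = x l gives the limit exp(-1/x),
    and l = 0 gives the limit 1.  For x <= 0 the event is null because R_n >= 1
    almost surely.

    The law of B_(n+1) is known only after an admissible history of positive
    probability.  A history of positive probability is shared by some point of
    the almost sure event where all R_n >= 1 ([regular_point]), and this makes
    it admissible; so it is enough to work with histories of such points. *)

(** * Limits of powers and of rescaled tails *)

(** For a < 1 the power is caught between exponentials: 1 - a <= exp(-a), and
    1 + b <= exp b for b = a / (1 - a) gives exp(-a / (1 - a)) <= 1 - a. *)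
Lemma cvg_exp_1B (R : realType) (a : R^nat) (s : R) :
  n%:R * a n @[n --> \oo] --> s ->
  (1 - a n) ^+ n @[n --> \oo] --> expR (- s).
Proof.
move=> nas.
have a0 : a n @[n --> \oo] --> (0 : R).
  rewrite -(mul0r s).
  apply: (@cvg_trans _ ((n%:R^-1 * (n%:R * a n)) @[n --> \oo])).
    apply: near_eq_cvg; near=> n; rewrite mulrA mulVf ?mul1r// pnatr_eq0 -lt0n.
    by near: n; exists 1%N.
  apply: cvgM nas; apply/gtr0_cvgV0; last exact: cvgr_idn.
  by near=> n; rewrite ltr0n; near: n; exists 1%N.
have b1 : (1 - a n) @[n --> \oo] --> (1 : R).
  by rewrite -[X in _ --> X]subr0; apply: cvgB => //; exact: cvg_cst.
apply: (@squeeze_cvgr _ _ _ _ (fun n => expR (- (n%:R * a n / (1 - a n))))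
    (fun n => expR (- (n%:R * a n)))).
- have /cvgr_gt/(_ 0 ltr01) := b1; apply: filterS => n b0.
  rewrite -mulrA -!mulrN !expRM_natl; apply/andP; split; apply: lerXn2r;
    rewrite ?nnegrE ?expR_ge0 ?(ltW b0)//; last exact: expR_ge1Dx.
  set b := a n * _; rewrite -[b]opprK expRN -[leRHS]invrK.
  rewrite lef_pV2 ?posrE ?invr_gt0 ?expR_gt0//.
  apply: le_trans (expR_ge1Dx _); rewrite le_eqVlt; apply/orP; left; apply/eqP.
  by rewrite /b; field; rewrite gt_eqF.
- apply: continuous_cvg; first exact: continuous_expR.
  apply: cvgN; rewrite -[X in _ --> X]divr1.
  by apply: cvgM => //; apply: cvgV => //; exact: oner_neq0.
- by apply: continuous_cvg; [exact: continuous_expR|exact: cvgN].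
Unshelve. all: by end_near.
Qed.

Section tail.
Context (R : realType) (y : R^nat) (c : R).
Hypotheses (c0 : 0 < c) (yc : y n / n%:R @[n --> \oo] --> c).

Lemma threshold_pinfty : y n @[n --> \oo] --> +oo.
Proof.
apply: (@cvg_trans _ ((n%:R * (y n / n%:R)) @[n --> \oo])).
  apply: near_eq_cvg; near=> n; rewrite mulrC divfK// pnatr_eq0 -lt0n.
  by near: n; exists 1%N.
have c2 : 0 < c / 2 by rewrite divr_gt0.
have c20 : c / 2 < c by rewrite ltr_pdivrMr// ltr_pMr// ltr1n.
have /cvgryPge y_big := @cvgr_idn R.
apply/cvgryPge => A.
have yc2 : \forall n \near \oo, c / 2 < y n / n%:R by apply: cvgr_gt yc _ _.
near=> n.
have n_big : A / (c / 2) <= n%:R by near: n; exact: y_big.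
have yn : c / 2 <= y n / n%:R by apply: ltW; near: n.
move: n_big; rewrite ler_pdivrMr// => An.
by apply: le_trans An _; exact: ler_wpM2l.
Unshelve. all: by end_near.
Qed.

(** With t = 1 / y n, which tends to 0 from the right, n F(t) is the product of
    F(t) / t and n / y n. *)
Lemma cvg_natM_tail (F : R -> R) (l : R) :
  F t / t @[t --> 0^'+] --> l ->
  n%:R * F (y n)^-1 @[n --> \oo] --> l / c.
Proof.
move=> Fl.
have y0 : \forall n \near \oo, 0 < y n.
  by have /cvgryPgt := threshold_pinfty; exact.
have yV : (y n)^-1 @[n --> \oo] --> (0 : R)^'+.
  have yV0 : (y n)^-1 @[n --> \oo] --> (0 : R).
    by apply/gtr0_cvgV0 => //; exact: threshold_pinfty.
  move=> A A0; have := yV0 _ A0.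
  by apply: filterS2 y0 => n yn; apply; rewrite /= invr_gt0.
apply: (@cvg_trans _ ((F (y n)^-1 / (y n)^-1 * (y n / n%:R)^-1) @[n --> \oo])).
  apply: near_eq_cvg; near=> n.
  have yn : 0 < y n by near: n.
  rewrite invfM !invrK mulrA mulrC; congr (_ * _).
  by rewrite mulfK // gt_eqF.
apply: cvgM; first exact: cvg_comp yV Fl.
by apply: cvgV => //; rewrite gt_eqF.
Unshelve. all: by end_near.
Qed.

End tail.

(** * Events determined by a discrete variable *)

(** The event is a countable union of fibers. *)
Lemma measurable_determined d (T : measurableType d) (C : countType)
    (X : T -> C) (A : set T) :
  (forall c, measurable (X @^-1` [set c])) ->
  (forall v w, X v = X w -> A v -> A w) -> measurable A.
Proof.
move=> mX XA.
have -> : A = \bigcup_c (A `&` X @^-1` [set c]).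
  by apply/seteqP; split=> [w Aw|w [c _ []]//]; exists (X w).
apply: countable_bigcupT_measurable; first exact: countableP.
move=> c; have [[w [Aw /= Xw]]|/nonemptyPn ->//] :=
  pselect ((A `&` X @^-1` [set c]) !=set0).
suff -> : A `&` X @^-1` [set c] = X @^-1` [set c] by [].
apply/seteqP; split=> [v []//|v /= Xv]; split=> //.
by apply: (XA w) => //; rewrite Xw Xv.
Qed.

(** Summing a comparison of conditional probabilities over the values of X: the
    law of total probability in the form of an inequality, which serves for
    lower bounds (a' = 1) as well as for upper bounds (a = 1). *)
Lemma le_measure_fibers d (T : measurableType d) (R : realType)
    (mu : {measure set T -> \bar R}) (C : countType) (X : T -> C)
    (A A' : set T) (a a' : R) :
  (forall c, measurable (X @^-1` [set c])) ->
  measurable A -> measurable A' -> 0 <= a -> 0 <= a' ->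
  (forall w, (a%:E * mu (A `&` X @^-1` [set X w]) <=
              a'%:E * mu (A' `&` X @^-1` [set X w]))%E) ->
  (a%:E * mu A <= a'%:E * mu A')%E.
Proof.
move=> mX mA mA' a0 a'0 le_fib.
(* Indexing the fibers by nat: cell k is a fiber of X, or empty. *)
pose cell k := X @^-1` (pickle @^-1` [set k]).
have cellP k : cell k = set0 \/ exists w, cell k = X @^-1` [set X w].
  have [[w /= wk]|/nonemptyPn ?] := pselect (cell k !=set0); last by left.
  right; exists w; apply/seteqP; split=> v /= vk; last by rewrite /cell /= vk.
  by apply: (pcan_inj pickleK); rewrite vk.
have mcell k : measurable (cell k).
  by case: (cellP k) => [->//|[w ->]]; exact: mX.
have sum_cell D : measurable D ->
    mu D = (\sum_(0 <= k <oo) mu (D `&` cell k))%E.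
  move=> mD; have {1}-> : D = \bigcup_k (D `&` cell k).
    by apply/seteqP; split=> [w Dw|w [k _ []]//]; exists (pickle (X w)).
  rewrite measure_bigcup.
  - by apply: eq_eseriesl => k; rewrite in_setT.
  - by move=> k _; exact: measurableI.
  - by move=> i j _ _ [w [[_ /= <-] [_ /= <-]]].
rewrite (sum_cell A)// (sum_cell A')// -!nneseriesZl//.
apply: lee_nneseries => [k _ _|k _]; first by rewrite mule_ge0.
by have [->|[w ->]] := cellP k; [rewrite !setI0 !measure0 !mule0|exact: le_fib].
Qed.

(** * Histories *)

Section oppenheim_variables.
Context (R : realType) (F : cumulativeBounded (0 : R) (1 : R))
  (phi : nat -> nat -> R) (q : forall n, n.-tuple nat -> R)
  (B : {RV (@unit_lebesgue R) >-> nat}^nat).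

Local Notation P := (@unit_lebesgue R).
Local Notation T := (measurableTypeR R).
Local Notation Rv := (oppenheim_R phi q B).

(** Histories are indexed by their sample points: every history that occurs has
    one, and h_j can be written B j w0. *)
Definition same_past n (w0 : T) : set T :=
  [set w | forall j, (1 <= j <= n)%N -> B j w = B j w0].
Definition maxima_le y n : set T :=
  [set w | forall k, (1 <= k <= n)%N -> Rv k w <= y].

Lemma oppenheim_max_leP y n w : (1 <= n)%N ->
  oppenheim_max phi q B n w <= y <-> maxima_le y n w.
Proof.
move=> n1; split=> [My k kn|Ry].
  apply: le_trans My; rewrite /oppenheim_max.
  by apply: (@le_bigmax_seq _ _ _ _ _ k xpredT (Rv^~ w));
    rewrite // mem_index_iota ltnS.
rewrite /oppenheim_max big_nat; apply: bigmax_le => [|k].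
  by apply: Ry; rewrite n1.
by rewrite ltnS; exact: Ry.
Qed.

Lemma eq_prefix_tuple n (h h' : nat -> nat) :
  prefix_tuple n h = prefix_tuple n h' <->
  forall j, (1 <= j <= n)%N -> h j = h' j.
Proof.
split=> [hh' [//|j] jn|hh'].
  by have := congr1 (fun t => tnth t (Ordinal jn)) hh'; rewrite !tnth_mktuple.
by apply: eq_from_tnth => i; rewrite !tnth_mktuple hh'//= ltn_ord.
Qed.

Lemma same_pastE n w0 :
  same_past n w0 =
  (fun w => prefix_tuple n (B^~ w)) @^-1` [set prefix_tuple n (B^~ w0)].
Proof. by apply/seteqP; split=> w /= /eq_prefix_tuple. Qed.

Lemma measurable_history n (c : n.-tuple nat) :
  measurable ((fun w : T => prefix_tuple n (B^~ w)) @^-1` [set c]).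
Proof.
have -> : (fun w : T => prefix_tuple n (B^~ w)) @^-1` [set c] =
    \bigcap_(j in [set j | (1 <= j <= n)%N]) (B j @^-1` [set nth 0%N c j.-1]).
  apply/seteqP; split=> [w /= <- [//|j] /= jn|w Bw].
    have := tnth_nth 0%N (prefix_tuple n (B^~ w)) (Ordinal jn).
    by rewrite tnth_mktuple.
  apply: eq_from_tnth => i; rewrite tnth_mktuple (tnth_nth 0%N).
  by apply: (Bw i.+1); rewrite /= ltn_ord.
by apply: bigcap_measurableType => j _; exact: measurable_funPTI.
Qed.

Lemma measurable_same_past n w0 : measurable (same_past n w0).
Proof. by rewrite same_pastE; exact: measurable_history. Qed.

Lemma measurable_next (Y : set nat) n w0 :
  measurable ([set w | Y (B n.+1 w)] `&` same_past n w0).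
Proof.
apply: measurableI; last exact: measurable_same_past.
exact: (measurable_funPTI (B n.+1) (Y := Y)).
Qed.

Lemma oppenheim_R_past n w0 w : (1 <= n)%N -> same_past n w0 w ->
  Rv n w = ((B n.+1 w)%:R + phi n (B n w0) * oppenheim_Q q B n w0)
           / (phi n (B n w0) * (1 + oppenheim_Q q B n w0)).
Proof.
move=> n1 ww0; rewrite /oppenheim_R /oppenheim_Q.
have -> : prefix_tuple n (B^~ w) = prefix_tuple n (B^~ w0).
  exact/eq_prefix_tuple.
by rewrite (ww0 n) // n1 leqnn.
Qed.

(** R_k involves B_1, ..., B_(k+1), so the first n ratios are known once n.+1 of
    the B_j are. *)
Lemma maxima_le_past y n w0 w :
  same_past n.+1 w0 w -> maxima_le y n w0 -> maxima_le y n w.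
Proof.
move=> ww0 y0 k /andP[k1 kn].
have pk : same_past k w0 w.
  by move=> j /andP[j1 jk]; apply: ww0; rewrite j1 (leq_trans jk)// ltnW.
rewrite (@oppenheim_R_past k w0)// (ww0 k.+1)//.
by have := y0 k; rewrite k1 kn (@oppenheim_R_past k w0 w0) => [|//|//]; exact.
Qed.

Lemma measurable_maxima_le y n : measurable (maxima_le y n).
Proof.
apply: (@measurable_determined _ _ _ (fun w => prefix_tuple n.+1 (B^~ w))).
  exact: measurable_history.
by move=> v w /eq_prefix_tuple vw; apply: maxima_le_past => j jn; rewrite vw.
Qed.

(** * The law of the next ratio given the history *)

Definition regular (w : T) : Prop :=
  [/\ w \in `[0, 1] & forall n, (1 <= n)%N -> 1 <= Rv n w].

Hypothesis opB : oppenheim F phi q B.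

Lemma ae_regular : {ae P, forall w, regular w}.
Proof.
have unit_ae : {ae P, forall w : T, w \in `[0 : R, 1]}.
  exists (~` `[0 : R, 1]%classic); split; first exact: measurableC.
    by rewrite /unit_lebesgue /mrestr setICl measure0.
  by move=> w /= nw w01; apply: nw.
by have := oppenheim_R_ge1 opB; apply: filterS2 unit_ae => w w01 Rw; split.
Qed.

Lemma regular_point (A : set T) : measurable A -> P A != 0%E ->
  exists2 w, A w & regular w.
Proof.
move=> mA PA; apply: contrapT => noreg; move/eqP: PA; apply.
apply: measure_negligible => //; apply: negligibleS ae_regular => w Aw /= rw.
by apply: noreg; exists w.
Qed.

Section regular_past.
Context (n : nat) (w0 : T).
Hypotheses (n1 : (1 <= n)%N) (reg0 : regular w0).

Local Notation f := (phi n (B n w0)).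
Local Notation x := (oppenheim_Q q B n w0).

Lemma regular_B_ge1 j : (1 <= j)%N -> (1 <= B j w0)%N.
Proof. by move=> j1; apply: (oppenheim_B_ge1 opB) => //; case: reg0. Qed.

Lemma regular_phi_ge1 j : (1 <= j)%N -> 1 <= phi j (B j w0).
Proof.
by move=> j1; apply: (oppenheim_phi_ge1 opB) => //; exact: regular_B_ge1.
Qed.

Lemma regular_Q_ge0 j : (1 <= j)%N -> 0 <= oppenheim_Q q B j w0.
Proof.
move=> j1; apply: (oppenheim_q_ge0 opB) => // i.
by rewrite tnth_mktuple; exact: regular_B_ge1.
Qed.

(** This is R_j >= 1 after clearing the denominator. *)
Lemma regular_admissible j : (1 <= j)%N ->
  phi j (B j w0) <= (B j.+1 w0)%:R.
Proof.
move=> j1; have [_ /(_ j j1)] := reg0.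
have := @regular_phi_ge1 j j1; have := @regular_Q_ge0 j j1.
rewrite /oppenheim_R => Q0 phi1.
rewrite ler_pdivlMr ?mul1r; first by rewrite mulrDr mulr1 lerD2r.
by rewrite mulr_gt0 // ?(lt_le_trans _ phi1)// ltr_pwDl.
Qed.

Lemma prob_next_eq k : (1 <= k)%N -> (0 < P (same_past n w0))%E ->
  P ([set w | B n.+1 w = k] `&` same_past n w0) =
  ((F (oppenheim_delta phi n (B n w0) k x)
    - F (oppenheim_delta phi n (B n w0) k.+1 x))%:E * P (same_past n w0))%E.
Proof.
move=> k1 P0.
(* The law is stated for a whole sequence h; its entry of index n.+1 is the
   value of the next variable. *)
pose h j := if j == n.+1 then k else B j w0.
have hE j : (j <= n)%N -> h j = B j w0.
  by rewrite /h; case: eqP => // ->; rewrite ltnn.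
have := @oppenheim_law _ _ _ _ _ opB n h n1.
have -> : [set w | forall j, (1 <= j <= n)%N -> B j w = h j] = same_past n w0.
  apply/seteqP; split=> w ww0 j /andP[j1 jn]; first by rewrite ww0 ?j1// hE.
  by rewrite hE // ww0 // j1.
have -> : prefix_tuple n h = prefix_tuple n (B^~ w0).
  by apply/eq_prefix_tuple => j /andP[_ jn]; exact: hE.
rewrite (hE n)// /h eqxx /cond_prob => law.
rewrite -law //.
- have fE := fin_num_measure P _ (measurable_next [set k] n w0).
  have fp := fin_num_measure P _ (measurable_same_past n w0).
  rewrite -[X in (_ = _ * X)%E](fineK fp) -[LHS](fineK fE) -EFinM divfK //.
  by rewrite gt_eqF // fine_gt0 // P0 ltey_eq fp.
- by move=> j /andP[j1 _]; case: eqP => // _; exact: regular_B_ge1.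
- move=> [//|[//|j]] /andP[_ jn] /=.
  by rewrite !ltn_eqF ?ltnS//; [exact: regular_admissible|exact: ltnW].
Qed.

(** The telescoping sum of the law over the values 1, ..., k; its first term
    is 1 because delta(1) = f (1 + x) / (1 + f x) >= 1. *)
Lemma prob_next_lt k : (0 < P (same_past n w0))%E ->
  P ([set w | (B n.+1 w < k.+1)%N] `&` same_past n w0) =
  ((1 - F (oppenheim_delta phi n (B n w0) k.+1 x))%:E * P (same_past n w0))%E.
Proof.
move=> P0; elim: k => [|k IHk].
  rewrite (oppenheim_df_ge1 (oppenheim_F opB)); last first.
    have f1 := regular_phi_ge1 n1; have x0 := regular_Q_ge0 n1.
    rewrite /oppenheim_delta ler_pdivlMr ?mul1r; first by nra.
    by rewrite ltr_pwDl// mulr_ge0// (le_trans _ f1).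
  rewrite subrr mul0e; apply/eqP; apply: contraT => PB.
  have m0 := measurable_next [set m | (m < 1)%N] n w0.
  have [w [/= Bw _] [w01 _]] := regular_point m0 PB.
  by have := oppenheim_B_ge1 opB (isT : (1 <= n.+1)%N) w01; rewrite leqNgt Bw.
have -> : [set w | (B n.+1 w < k.+2)%N] `&` same_past n w0 =
    ([set w | (B n.+1 w < k.+1)%N] `&` same_past n w0) `|`
    ([set w | B n.+1 w = k.+1] `&` same_past n w0).
  rewrite -setIUl; congr (_ `&` _); apply/seteqP; split=> w /=.
    by rewrite ltnS leq_eqVlt => /orP[/eqP|]; [right|left].
  by case=> [/ltnW//|->].
have mlt := measurable_next [set m | (m < k.+1)%N] n w0.
have meq := measurable_next [set k.+1] n w0.
transitivity (P ([set w | (B n.+1 w < k.+1)%N] `&` same_past n w0) +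
              P ([set w | B n.+1 w = k.+1] `&` same_past n w0))%E.
  apply: measureU => //; apply/seteqP; split=> w // [[/= + _] [/= Bw _]].
  by rewrite Bw ltnn.
rewrite IHk prob_next_eq// -muleDl ?fin_num_measure//; last first.
  exact: measurable_same_past.
by rewrite -EFinD; congr ((_)%:E * _)%E; ring.
Qed.

(** R_n <= y says B_(n+1) <= t for t := y f (1 + x) - f x, that is,
    B_(n+1) < k + 1 with k the integer part of t.  Then k + 1 + f x lies between
    y f (1 + x) and y f (1 + x) + 1 <= (y + 1) f (1 + x), so that delta(k+1) is
    between 1 / (y + 1) and 1 / y. *)
Lemma prob_next_R_le y : 1 <= y -> (0 < P (same_past n w0))%E ->
  ((1 - F y^-1)%:E * P (same_past n w0)
   <= P ([set w | (Rv n w <= y)%R] `&` same_past n w0)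
   <= (1 - F (y + 1)^-1)%:E * P (same_past n w0))%E.
Proof.
move=> y1 P0.
have f1 := regular_phi_ge1 n1; have x0 := regular_Q_ge0 n1.
pose t := y * (f * (1 + x)) - f * x.
have fx0 : 0 < f * (1 + x) by rewrite mulr_gt0 ?(lt_le_trans _ f1)// ltr_pwDl.
have t0 : 0 <= t.
  rewrite subr_ge0; apply: (@le_trans _ _ (f * (1 + x))).
    by rewrite mulrDr mulr1 lerDr (le_trans _ f1).
  by rewrite ler_peMl// ltW.
have -> : [set w | Rv n w <= y] `&` same_past n w0 =
    [set w | (B n.+1 w < (Num.truncn t).+1)%N] `&` same_past n w0.
  apply/seteqP; split=> w [/= + pw]; rewrite (oppenheim_R_past n1 pw);
    rewrite ler_pdivrMr// ltnS truncn_ge_nat// /t -lerBrDr => ?; split=> //.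
rewrite prob_next_lt//.
have /andP[tl tr] := truncn_itv t0.
have Pge0 : (0 <= P (same_past n w0))%E by exact: ltW.
set k := Num.truncn t in tl tr *.
have d0 : 0 < k.+1%:R + f * x by rewrite ltr_pwDl// mulr_ge0// (le_trans _ f1).
have y0 : 0 < y by exact: lt_le_trans y1.
have fx1 : 1 <= f * (1 + x).
  by rewrite mulrDr mulr1 (le_trans f1)// lerDl mulr_ge0// (le_trans _ f1).
apply/andP; split; apply: lee_wpmul2r => //; rewrite lee_fin lerB//;
  apply: cumulative_is_nondecreasing; rewrite /oppenheim_delta.
  by rewrite ler_pdivrMr// ler_pdivlMl// -lerBlDr ltW.
rewrite ler_pdivlMr// ler_pdivrMl ?addr_gt0//.
by rewrite mulrDl mul1r -natr1 addrAC lerD// -lerBrDr.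
Qed.

End regular_past.

(** * The distribution function of the maxima *)

Lemma F_le1 z : F z <= 1.
Proof.
have [z1|/ltW z1] := leP 1 z.
  by rewrite (oppenheim_df_ge1 (oppenheim_F opB)).
have F1 := oppenheim_df_ge1 (oppenheim_F opB) (lexx 1).
by rewrite -[leRHS]F1; exact: cumulative_is_nondecreasing.
Qed.

(** On a history of length n.+1 the event for the first n ratios is everything
    or nothing, so only the condition on the ratio of index n.+1 remains. *)
Lemma prob_maxima_le_step y n w : 1 <= y ->
  ((1 - F y^-1)%:E * P (maxima_le y n `&` same_past n.+1 w)
     <= P (maxima_le y n.+1 `&` same_past n.+1 w)
     <= (1 - F (y + 1)^-1)%:E * P (maxima_le y n `&` same_past n.+1 w))%E.
Proof.
move=> y1.
have [Pw0|Pw0] := eqVneq (P (same_past n.+1 w)) 0%E.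
  have P0 (A : set T) : measurable A -> P (A `&` same_past n.+1 w) = 0%E.
    move=> mA.
    apply: subset_measure0 Pw0; rewrite ?subIsetr//; last first.
      exact: measurable_same_past.
    by apply: measurableI => //; exact: measurable_same_past.
  by rewrite !P0 ?mule0 ?lexx//; exact: measurable_maxima_le.
have [w0 ww0 reg0] := regular_point (measurable_same_past n.+1 w) Pw0.
(* Replacing w by a regular point with the same history. *)
have -> : same_past n.+1 w = same_past n.+1 w0.
  by apply/seteqP; split=> v vw j jn; rewrite vw// ww0.
have [y0|ny0] := pselect (maxima_le y n w0); last first.
  have empty m : (n <= m)%N -> maxima_le y m `&` same_past n.+1 w0 = set0.
    move=> nm; apply/seteqP; split=> // v [vy vw0]; apply: ny0.
    apply: (@maxima_le_past y n v w0) => [j jn|k /andP[k1 kn]].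
      by rewrite vw0.
    by apply: vy; rewrite k1 (leq_trans kn).
  by rewrite !empty// measure0 !mule0 lexx.
have -> : maxima_le y n `&` same_past n.+1 w0 = same_past n.+1 w0.
  by apply/setIidPr => v vw0; exact: maxima_le_past vw0 y0.
have -> : maxima_le y n.+1 `&` same_past n.+1 w0 =
    [set v | Rv n.+1 v <= y] `&` same_past n.+1 w0.
  apply/seteqP; split=> v [/= vy vw0]; split=> //.
    by apply: vy; rewrite /= leqnn.
  move=> k /andP[k1]; rewrite leq_eqVlt => /orP[/eqP->//|kn].
  by apply: (maxima_le_past vw0 y0); rewrite k1.
apply: prob_next_R_le => //.
have -> : same_past n.+1 w0 = same_past n.+1 w.
  by apply/seteqP; split=> v vw j jn; rewrite vw// ww0.
by rewrite lt0e Pw0 measure_ge0.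
Qed.

Lemma prob_maxima_le y n : 1 <= y ->
  (((1 - F y^-1) ^+ n)%:E <= P (maxima_le y n)
   <= ((1 - F (y + 1)^-1) ^+ n)%:E)%E.
Proof.
move=> y1; elim: n => [|n /andP[IHl IHu]].
  have -> : maxima_le y 0 = setT by apply/seteqP; split=> // w _ [].
  by rewrite probability_setT !expr0 lexx.
have a0 : 0 <= 1 - F y^-1 by rewrite subr_ge0 F_le1.
have b0 : 0 <= 1 - F (y + 1)^-1 by rewrite subr_ge0 F_le1.
have mX := @measurable_history n.+1.
have step w : _ := prob_maxima_le_step n w y1.
apply/andP; split.
  apply: (@le_trans _ _ ((1 - F y^-1)%:E * P (maxima_le y n))%E).
    by rewrite exprS EFinM lee_wpmul2l.
  rewrite -[leRHS]mul1e.
  apply: (le_measure_fibers mX) => // [||w]; try exact: measurable_maxima_le.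
  by rewrite -same_pastE mul1e; case/andP: (step w).
apply: (@le_trans _ _ ((1 - F (y + 1)^-1)%:E * P (maxima_le y n))%E);
  last first.
  by rewrite exprS EFinM lee_wpmul2l.
rewrite -[leLHS]mul1e.
apply: (le_measure_fibers mX) => // [||w]; try exact: measurable_maxima_le.
by rewrite -same_pastE mul1e; case/andP: (step w).
Qed.

Lemma oppenheim_max_setE y n : (1 <= n)%N ->
  [set w | oppenheim_max phi q B n w <= y] = maxima_le y n.
Proof. by move=> n1; apply/seteqP; split=> w /=; rewrite oppenheim_max_leP. Qed.

Lemma prob_max_lt1 y n : y < 1 -> (1 <= n)%N ->
  P [set w | oppenheim_max phi q B n w <= y] = 0%E.
Proof.
move=> y1 n1; rewrite oppenheim_max_setE//; apply/eqP; apply: contraT => PM.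
have [w My [_ Rw]] := regular_point (measurable_maxima_le y n) PM.
by have := le_lt_trans (My 1%N n1) y1; rewrite ltNge Rw.
Qed.

(** Both y n and y n + 1 are equivalent to c n, so the two bounds of
    [prob_maxima_le] have the same limit. *)
Lemma cvg_prob_max (y : R^nat) (c l : R) :
  F t / t @[t --> 0^'+] --> l -> 0 < c -> y n / n%:R @[n --> \oo] --> c ->
  P [set w | oppenheim_max phi q B n w <= y n] @[n --> \oo]
    --> (expR (- (l / c)))%:E.
Proof.
move=> Fl c0 yc.
have y1c : (y n + 1) / n%:R @[n --> \oo] --> c.
  rewrite -(addr0 c); under eq_fun do rewrite mulrDl mul1r.
  apply: cvgD => //.
  apply/gtr0_cvgV0; last exact: cvgr_idn.
  by near=> n; rewrite ltr0n; near: n; exists 1%N.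
have /cvgryPge y_big := threshold_pinfty c0 yc.
apply: (@squeeze_cvge _ _ _ _ (fun n => ((1 - F (y n)^-1) ^+ n)%:E) _
                              (fun n => ((1 - F (y n + 1)^-1) ^+ n)%:E)).
- near=> n; rewrite oppenheim_max_setE; last by near: n; exists 1%N.
  by apply: prob_maxima_le; near: n; exact: y_big.
- apply: cvg_EFin; first exact: nearW.
  exact: (cvg_exp_1B (cvg_natM_tail c0 yc Fl)).
- apply: cvg_EFin; first exact: nearW.
  exact: (cvg_exp_1B (cvg_natM_tail c0 y1c Fl)).
Unshelve. all: by end_near.
Qed.

Lemma cvg_prob_max_linear (m l x : R) :
  F t / t @[t --> 0^'+] --> l -> 0 < m ->
  P [set w | oppenheim_max phi q B n w <= x * n%:R * m] @[n --> \oo]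
    --> (if x <= 0 then 0 else expR (- (l / (x * m))))%:E.
Proof.
move=> Fl m0; have [x0|x0] := leP x 0.
  apply: (@cvg_trans _ ((fun=> 0%E : \bar R) @ \oo)); last exact: cvg_cst.
  apply: near_eq_cvg; near=> n.
  rewrite prob_max_lt1//; last by near: n; exists 1%N.
  apply: le_lt_trans ltr01; rewrite -mulrA.
  by apply: mulr_le0_ge0 => //; rewrite mulr_ge0// ltW.
apply: cvg_prob_max; [exact: Fl|exact: mulr_gt0|].
apply: (@cvg_trans _ ((fun=> x * m) @ \oo)); last exact: cvg_cst.
apply: near_eq_cvg; near=> n; rewrite mulrAC mulfK// pnatr_eq0 -lt0n.
by near: n; exists 1%N.
Unshelve. all: by end_near.
Qed.

End oppenheim_variables.

Lemma frechet_cdf1 (R : realType) (x : R) :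
  frechet_cdf 1 x = if x <= 0 then 0 else expR (- (1 / x)).
Proof.
rewrite /frechet_cdf; case: ltP => // x0.
by rewrite powR_inv1 ?div1r// ltW.
Qed.

Theorem corollary4 (R : realType) (F : cumulativeBounded (0 : R) (1 : R))
    (phi : nat -> nat -> R) (q : forall n, n.-tuple nat -> R)
    (B : {RV (@unit_lebesgue R) >-> nat}^nat) (l : R) :
  oppenheim F phi q B ->
  F t / t @[t --> 0^'+] --> l ->
  (exists2 beta : R, 0 < beta & forall x y, y <= x -> F x - F y <= beta * (x - y)) ->
  (0 < l ->
     in_max_domain_of_attraction (@unit_lebesgue R) (oppenheim_max phi q B)
       (frechet_cdf 1) /\
     forall x : R,
       unit_lebesgue [set w | oppenheim_max phi q B n w <= x * n%:R * l]
         @[n --> \oo] --> (if x <= 0 then 0 else expR (- (1 / x)))%:E) /\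
  (l = 0 ->
     forall x : R,
       unit_lebesgue [set w | oppenheim_max phi q B n w <= x * n%:R]
         @[n --> \oo] --> (if x <= 0 then 0 else 1)%:E).
Proof.
move=> opB Fl _; split=> [l0|l0 x].
  have limP (x : R) :
      unit_lebesgue [set w | oppenheim_max phi q B n w <= x * n%:R * l]
        @[n --> \oo] --> (if x <= 0 then 0 else expR (- (1 / x)))%:E.
    have := cvg_prob_max_linear (x := x) opB Fl l0.
    by rewrite [x * l]mulrC invfM mulrA divff ?gt_eqF.
  (* The maximum with 1 keeps the scale positive at n = 0. *)
  split=> //; exists (fun n => (maxn n 1)%:R * l), (fun=> 0); split.
    by move=> n; rewrite mulr_gt0// ltr0n leq_max orbT.
  move=> x _; rewrite frechet_cdf1; apply: cvg_trans (limP x).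
  apply: near_eq_cvg; near=> n; congr (unit_lebesgue _).
  have n1 : (1 <= n)%N by near: n; exists 1%N.
  have -> : (maxn n 1)%:R * l * x + 0 = x * n%:R * l.
    by rewrite (maxn_idPl n1); ring.
  by [].
have := cvg_prob_max_linear (x := x) opB Fl ltr01.
under eq_fun do under eq_set do rewrite mulr1.
by rewrite l0 mul0r oppr0 expR0.
Unshelve. all: by end_near.
Qed.
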